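(* Let $L$ be an r-lattice having property delta, and let $Q\in L$. Then $Q$ is a cancellation element of $L$ if and only if, for each maximal element $m$ of $L$, the localization $Q_m$ is a principal regular element of $L_m$.
   Context: A (multiplicative) lattice is a complete lattice $(L,\le)$ with bottom element $0$ and top element $1$ which is also a commutative monoid with identity $1$ (the top element) such that $a(\bigvee_\alpha b_\alpha)=\bigvee_\alpha (ab_\alpha)$ for all $a\in L$ and all families $(b_\alpha)$ in $L$ (including the empty family, so $a0=0$). $L$ is modular if $a\ge b$ implies $a\wedge(b\vee c)=b\vee(a\wedge c)$. An element $c$ is compact if $c\le\bigvee S$ with $S\subseteq L$ implies $c\le \bigvee T$ for some finite $T\subseteq S$. A maximal element is an element maximal in $L-\{1\}$. An element $p\ne 1$ is prime if $ab\le p$ implies $a\le p$ or $b\le p$. For $a,b\in L$, $(a:b)=\bigvee\{c\in L \mid bc\le a\}$. An element $x$ is principal if it is both meet principal, i.e. $a\wedge bx=((a:x)\wedge b)x$ for all $a,b\in L$, and join principal, i.e. $a\vee(b:x)=((ax\vee b):x)$ for all $a,b\in L$. An element $Q$ is a cancellation element if $Qa=Qb$ with $a,b\in L$ implies $a=b$. A principal element $c$ is regular if $(0:c)=0$. $L$ is a C-lattice if $1$ is compact, the set of compact elements is closed under multiplication, and every element is a join of compact elements. A subset $G\subseteq L$ generates $L$ if every element of $L$ is a join of elements of $G$. An r-lattice is a modular C-lattice generated by a set of principal elements. Property delta: an r-lattice $L$ has property delta if $L$ is generated by a set $\Delta$ of principal elements such that for all $x,y\in\Delta$ there exists $\delta\in\Delta$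 with $x^2\vee y^2=x^2\vee\delta=y^2\vee\delta$. Localization: for a C-lattice $L$ and a multiplicatively closed set $S$ of compact elements, put $a_S=\bigvee\{(a:s)\mid s\in S\}$ for $a\in L$ and $L_S=\{a_S\mid a\in L\}$, which is a multiplicative lattice with the order of $L$, join $A\mapsto(\bigvee A)_S$, meet $A\mapsto\bigwedge A$, and product $(a,b)\mapsto (ab)_S$ (its bottom element is $0_S$, its top element is $1$). For a prime element $p$ (in particular a maximal element, since maximal elements are prime), $L_p$ and $a_p$ denote $L_T$ and $a_T$ with $T=\{c \text{ compact}\mid c\not\le p\}$. ''Principal'' and ''regular'' in $L_m$ refer to the lattice $L_m$ with these operations. *)

(* Defs.v *)
From HB Require Import structures.
From mathcomp Require Import all_boot all_order.
From mathcomp Require Import boolp classical_sets cardinality.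

Set Implicit Arguments.
Unset Strict Implicit.
Unset Printing Implicit Defensive.

Import Order.TTheory.
Local Open Scope classical_set_scope.
Local Open Scope order_scope.

(* The default value only matters for non-existing suprema; in particular
   bigjoin set0 = \bot. *)
Definition bigjoin d (L : bPOrderType d) (A : set L) : L := supremum \bot A.

(* The bottom, top, binary meet and join of L are those of tbLatticeType.
   The case B = set0 of mulg_bigjoin says a * \bot = \bot. *)
HB.mixin Record isMultLattice (d : Order.disp_t) L
    of Order.TBLattice d L & monoid.Monoid L := {
  supremums_neq0 : forall A : set L, supremums A !=set0;
  mulgC : commutative (fun a b : L => (a * b)%g);
  oneg_top : 1%g = \top :> L;
  mulg_bigjoin : forall (a : L) (B : set L),
    (a * bigjoin B)%g = bigjoin [set (a * b)%g | b in B]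
}.

#[short(type="multLatticeType")]
HB.structure Definition MultLattice (d : Order.disp_t) :=
  { L of Order.TBLattice d L & monoid.Monoid L & isMultLattice d L }.

Section Notions.
Context {d : Order.disp_t} {L : multLatticeType d}.
Implicit Types (a b c m p x : L) (A G : set L).

Definition residual a b : L := bigjoin [set c | (b * c)%g <= a].

Definition modular_lattice :=
  forall a b c : L, b <= a -> a `&` (b `|` c) = b `|` (a `&` c).

Definition compact_element c :=
  forall A, c <= bigjoin A ->
    exists T : set L, [/\ finite_set T, T `<=` A & c <= bigjoin T].

Definition maximal_element m :=
  m != \top /\ forall x, x != \top -> m <= x -> x = m.

Definition prime_element p :=
  p != \top /\ forall a b, (a * b)%g <= p -> a <= p \/ b <= p.

Definition meet_principal x :=
  forall a b, a `&` (b * x)%g = ((residual a x `&` b) * x)%g.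

Definition join_principal x :=
  forall a b, a `|` residual b x = residual ((a * x)%g `|` b) x.

Definition principal x := meet_principal x /\ join_principal x.

Definition cancellation_element x :=
  forall a b, (x * a)%g = (x * b)%g -> a = b.

Definition principal_regular x := principal x /\ residual \bot x = \bot.

Definition generating G := forall a, exists2 A, A `<=` G & a = bigjoin A.

Definition property_delta :=
  exists D : set L, [/\ D `<=` principal, generating D &
    forall x y, D x -> D y -> exists2 z, D z &
      (x ^+ 2)%g `|` (y ^+ 2)%g = (x ^+ 2)%g `|` z /\
      (x ^+ 2)%g `|` z = (y ^+ 2)%g `|` z].

End Notions.
Arguments modular_lattice {d} L.
Arguments property_delta {d} L.

HB.mixin Record isCLattice (d : Order.disp_t) L of MultLattice d L := {
  compact1 : compact_element (1%g : L);
  compactM : forall a b : L,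
    compact_element a -> compact_element b -> compact_element (a * b)%g;
  compact_generating : generating (@compact_element d L)
}.

#[short(type="cLatticeType")]
HB.structure Definition CLattice (d : Order.disp_t) :=
  { L of MultLattice d L & isCLattice d L }.

HB.mixin Record isRLattice (d : Order.disp_t) L of CLattice d L := {
  rlattice_modular : modular_lattice L;
  principal_generating :
    exists2 G : set L, G `<=` principal & generating G
}.

#[short(type="rLatticeType")]
HB.structure Definition RLattice (d : Order.disp_t) :=
  { L of CLattice d L & isRLattice d L }.

Section MultLatticeTheory.
Context {d : Order.disp_t} {L : multLatticeType d}.
Implicit Types (a b c m p x y : L) (A B : set L).

Lemma bigjoin_supremums A : supremums A (bigjoin A).
Proof.
rewrite /bigjoin /supremum; case: ifPn => [/eqP ->|_].
  by split=> [x []|x _]; exact: le0x.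
by have [x Ax] := supremums_neq0 A; case: xgetP => [y //|/(_ x)].
Qed.

Lemma bigjoin_ub A x : A x -> x <= bigjoin A.
Proof. by case: (bigjoin_supremums A) => + _; apply. Qed.

Lemma bigjoin_le A y : (forall x, A x -> x <= y) -> bigjoin A <= y.
Proof. by case: (bigjoin_supremums A) => _; apply. Qed.

Lemma bigjoin_eq A y : supremums A y -> bigjoin A = y.
Proof. exact: (is_subset1_supremums (bigjoin_supremums A)). Qed.

Lemma bigjoin2 a b : bigjoin [set a; b] = a `|` b.
Proof.
apply: bigjoin_eq; split => [x [->|->]|x ub]; rewrite ?leUl ?leUr//.
by rewrite leUx !ub//=; [right|left].
Qed.

Lemma mulgU a b c : (a * (b `|` c))%g = (a * b)%g `|` (a * c)%g.
Proof.
rewrite -bigjoin2 mulg_bigjoin -bigjoin2; congr bigjoin.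
by rewrite image_setU !image_set1.
Qed.

Lemma lemulg2l a b c : b <= c -> (a * b)%g <= (a * c)%g.
Proof. by move/join_r <-; rewrite mulgU leUl. Qed.

Lemma lemulg2r a b c : b <= c -> (b * a)%g <= (c * a)%g.
Proof. by rewrite ![(_ * a)%g]mulgC; exact: lemulg2l. Qed.

Lemma lemulgl a b : (a * b)%g <= a.
Proof. by rewrite -[leRHS]mulg1 lemulg2l// oneg_top lex1. Qed.

Lemma lemulgr a b : (a * b)%g <= b.
Proof. by rewrite mulgC lemulgl. Qed.

Lemma le_residual a b c : (c <= residual a b) = ((b * c)%g <= a).
Proof.
apply/idP/idP => [cab|bca]; last exact: bigjoin_ub.
apply: le_trans (lemulg2l b cab) _; rewrite mulg_bigjoin.
by apply: bigjoin_le => _ [x /= + <-].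
Qed.

Lemma maximal_prime m : maximal_element m -> prime_element m.
Proof.
move=> [m1 mmax]; split=> // a b abm.
have joinm x : ~~ (x <= m) -> x `|` m = \top.
  move=> xm; apply/eqP/negP => /negP xm1.
  by move: xm; rewrite -(mmax _ xm1 (leUr _ _)) leUl.
case: (boolP (a <= m)) => [|/joinm am]; first by left.
case: (boolP (b <= m)) => [|/joinm bm]; first by right.
suff: \top <= m by rewrite le1x (negbTE m1).
rewrite -oneg_top -[X in X <= _]mulg1 {1}oneg_top oneg_top -{1}am -bm.
rewrite mulgU leUx lemulgr andbT mulgC mulgU leUx lemulgr andbT.
by rewrite mulgC.
Qed.

End MultLatticeTheory.

(* Nonemptiness is part of being a multiplicatively closed set: without it
   a_S would be \bot for every a. *)
Record multClosed (d : Order.disp_t) (L : cLatticeType d) := MultClosed {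
  multClosed_set : set L;
  multClosed_neq0 : multClosed_set !=set0;
  multClosed_compact : multClosed_set `<=` compact_element;
  multClosedM : forall s t, multClosed_set s -> multClosed_set t ->
    multClosed_set (s * t)%g
}.

Section PrimeCompl.
Context {d : Order.disp_t} {L : cLatticeType d} (p : L).

Definition compact_nle := [set c : L | compact_element c /\ ~~ (c <= p)].

Hypothesis p_prime : prime_element p.

Lemma compact_nle_neq0 : compact_nle !=set0.
Proof.
exists 1%g; split; first exact: compact1.
by rewrite oneg_top le1x; case: p_prime.
Qed.

Lemma compact_nle_compact : compact_nle `<=` compact_element.
Proof. by move=> c []. Qed.

Lemma compact_nleM s t :
  compact_nle s -> compact_nle t -> compact_nle (s * t)%g.
Proof.
move=> [cs sp] [ct tp]; split; first exact: compactM.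
by apply/negP => /(proj2 p_prime)[]; apply/negP.
Qed.

Definition prime_multClosed : multClosed L :=
  MultClosed compact_nle_neq0 compact_nle_compact compact_nleM.

End PrimeCompl.

Section Localization.
Context {d : Order.disp_t} {L : cLatticeType d} (S : multClosed L).
Implicit Types (a b c : L) (A B : set L).

(* a_S as an element of L *)
Definition loc_val a : L := bigjoin [set residual a s | s in multClosed_set S].

Lemma loc_val_ge a : a <= loc_val a.
Proof.
have [s Ss] := multClosed_neq0 S.
apply: (@le_trans _ _ (residual a s)); first by rewrite le_residual lemulgr.
by apply: bigjoin_ub; exists s.
Qed.

Lemma le_loc_val a b : a <= b -> loc_val a <= loc_val b.
Proof.
move=> ab; apply: bigjoin_le => _ [s Ss <-].
apply: (@le_trans _ _ (residual b s)); last by apply: bigjoin_ub; exists s.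
by rewrite le_residual (le_trans _ ab)// -le_residual.
Qed.

Lemma compact_le_loc_val c a : compact_element c ->
  c <= loc_val a <-> exists2 s, multClosed_set S s & (s * c)%g <= a.
Proof.
move=> cc; split => [/cc[T [finT TS cT]]|[s Ss sca]]; last first.
  apply: (@le_trans _ _ (residual a s)); first by rewrite le_residual.
  by apply: bigjoin_ub; exists s.
suff [s Ss Ts] : exists2 s, multClosed_set S s & forall t, T t -> t <= residual a s.
  exists s => //; rewrite -le_residual.
  exact: le_trans cT (bigjoin_le Ts).
move/finite_seqP: finT TS => [r ->] {T cT}.
elim: r => [_|t r IHr rS].
  by have [s Ss] := multClosed_neq0 S; exists s => // t; rewrite /= in_nil.
have [|s Ss rs] := IHr; first by move=> u /= ur; apply: rS; rewrite /= inE ur orbT.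
have [|u Su ut] := rS t; first by rewrite /= inE eqxx.
exists (s * u)%g; first exact: multClosedM.
move=> v /=; rewrite inE => /orP[/eqP ->|vr]; rewrite le_residual.
  rewrite -mulgA; apply: le_trans (lemulgr _ _) _.
  by rewrite -le_residual ut.
rewrite (mulgC s) -mulgA; apply: le_trans (lemulgr _ _) _.
by rewrite -le_residual rs.
Qed.

Lemma compact_leP a b :
  (forall c, compact_element c -> c <= a -> c <= b) -> a <= b.
Proof.
move=> cab; have [A Ac aA] := compact_generating a.
rewrite {1}aA; apply: bigjoin_le => c Ac'; apply: cab; first exact: Ac.
by rewrite aA bigjoin_ub.
Qed.

Lemma loc_valK a : loc_val (loc_val a) = loc_val a.
Proof.
apply/eqP; rewrite eq_le loc_val_ge andbT; apply: compact_leP => c cc.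
move/(compact_le_loc_val _ cc) => [s Ss].
have csc : compact_element (s * c)%g.
  by apply: compactM => //; apply: multClosed_compact Ss.
move/(compact_le_loc_val _ csc) => [t St tsc].
by apply/(compact_le_loc_val _ cc); exists (t * s)%g;
  [exact: multClosedM|rewrite -mulgA].
Qed.

Lemma loc_val_le a b : a <= loc_val b -> loc_val a <= loc_val b.
Proof. by move/le_loc_val; rewrite loc_valK. Qed.

Lemma mulg_loc_val a b : (a * loc_val b)%g <= loc_val (a * b)%g.
Proof.
rewrite mulg_bigjoin; apply: bigjoin_le => _ [_ [s Ss <-] <-].
apply: (@le_trans _ _ (residual (a * b)%g s)); last first.
  by apply: bigjoin_ub; exists s.
by rewrite le_residual mulgA (mulgC s) -mulgA lemulg2l// -le_residual.
Qed.

Lemma loc_valMr a b : loc_val (a * loc_val b)%g = loc_val (a * b)%g.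
Proof.
apply/eqP; rewrite eq_le loc_val_le ?mulg_loc_val//.
exact/le_loc_val/lemulg2l/loc_val_ge.
Qed.

Lemma loc_valMl a b : loc_val (loc_val a * b)%g = loc_val (a * b)%g.
Proof. by rewrite mulgC loc_valMr mulgC. Qed.

(* L_S, with the order of L and the product (a, b) |-> (ab)_S *)
Definition localization := {x : L | x \in range loc_val}.

HB.instance Definition _ := SubChoice.on localization.
HB.instance Definition _ :=
  Order.SubChoice_isSubPOrder.Build d L (mem (range loc_val)) d localization.

Lemma loc_subproof a : loc_val a \in range loc_val.
Proof. by rewrite inE; exists a. Qed.

(* a_S as an element of L_S *)
Definition loc a : localization :=
  exist (fun x : L => x \in range loc_val) (loc_val a) (loc_subproof a).

Implicit Types x y z : localization.

Lemma val_loc a : val (loc a) = loc_val a. Proof. by []. Qed.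

Lemma leE_loc x y : (x <= y) = (val x <= val y).
Proof. by rewrite leEsub. Qed.

Lemma loc_val_val x : loc_val (val x) = val x.
Proof. by case: x => x /=; rewrite inE => -[a _ <-]; rewrite loc_valK. Qed.

Lemma valK_loc x : loc (val x) = x.
Proof. exact/val_inj/loc_val_val. Qed.

Lemma loc_le a x : (loc a <= x) = (a <= val x).
Proof.
rewrite leE_loc val_loc; apply/idP/idP => [|ax].
  exact/le_trans/loc_val_ge.
by rewrite -loc_val_val; apply: le_loc_val.
Qed.

Definition loc_meet x y := loc (val x `&` val y).
Definition loc_join x y := loc (val x `|` val y).
Definition loc_mul x y := loc (val x * val y)%g.

Lemma val_loc_meet x y : val (loc_meet x y) = val x `&` val y.
Proof.
apply/eqP; rewrite val_loc eq_le loc_val_ge andbT lexI.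
by apply/andP; split; rewrite -[leRHS]loc_val_val le_loc_val ?leIl ?leIr.
Qed.

Lemma loc_meetP x y z : (x <= loc_meet y z) = (x <= y) && (x <= z).
Proof. by rewrite !leE_loc val_loc_meet lexI. Qed.

Lemma loc_joinP x y z : (loc_join x y <= z) = (x <= z) && (y <= z).
Proof. by rewrite loc_le leUx -!leE_loc. Qed.

Lemma loc_le0x x : loc \bot <= x.
Proof. by rewrite loc_le le0x. Qed.

Lemma loc_lex1 x : x <= loc \top.
Proof. by rewrite leE_loc (le_trans (lex1 _))// loc_val_ge. Qed.

HB.instance Definition _ :=
  Order.POrder_MeetJoin_isLattice.Build d localization loc_meetP loc_joinP.
HB.instance Definition _ := Order.hasBottom.Build d localization loc_le0x.
HB.instance Definition _ := Order.hasTop.Build d localization loc_lex1.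

Lemma loc_mulC : commutative loc_mul.
Proof. by move=> x y; rewrite /loc_mul mulgC. Qed.

Lemma loc_mulA : associative loc_mul.
Proof.
by move=> x y z; apply: val_inj; rewrite !val_loc loc_valMr loc_valMl mulgA.
Qed.

Lemma loc_mul1 : left_id (loc 1%g) loc_mul.
Proof.
by move=> x; apply: val_inj; rewrite val_loc loc_valMl mul1g loc_val_val.
Qed.

Lemma loc_mulr1 : right_id (loc 1%g) loc_mul.
Proof. by move=> x; rewrite loc_mulC loc_mul1. Qed.

HB.instance Definition _ :=
  monoid.isMonoid.Build localization loc_mulA loc_mul1 loc_mulr1.

Lemma loc_supremums (A : set localization) :
  supremums A (loc (bigjoin (val @` A))).
Proof.
split => [x Ax|y ub].
  rewrite leE_loc; apply: le_trans (loc_val_ge _).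
  by apply: bigjoin_ub; exists x.
rewrite loc_le; apply: bigjoin_le => _ [x Ax <-].
by rewrite -leE_loc; exact: ub.
Qed.

Lemma loc_supremums_neq0 (A : set localization) : supremums A !=set0.
Proof. by eexists; exact: loc_supremums. Qed.

Lemma loc_bigjoin (A : set localization) :
  bigjoin A = loc (bigjoin (val @` A)).
Proof.
rewrite /bigjoin /supremum; case: ifPn => [/eqP ->|_].
  by rewrite image_set0 eqxx.
case: xgetP => [y _ Ay|/(_ _ (loc_supremums A))//].
exact: is_subset1_supremums Ay (loc_supremums A).
Qed.

Lemma loc_oneg_top : 1%g = \top :> localization.
Proof. by apply: val_inj; rewrite !val_loc oneg_top. Qed.

Lemma loc_mulg_bigjoin x (B : set localization) :
  (x * bigjoin B)%g = bigjoin [set (x * y)%g | y in B].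
Proof.
rewrite !loc_bigjoin; apply: val_inj.
rewrite val_loc [val (loc _)]val_loc loc_valMr mulg_bigjoin.
apply/eqP; rewrite eq_le; apply/andP; split.
  apply/le_loc_val/bigjoin_le => _ [_ [y By <-] <-].
  apply: le_trans (loc_val_ge _) _; rewrite -[leLHS]/(val (x * y)%g).
  by apply: bigjoin_ub; exists (x * y)%g => //; exists y.
apply/loc_val_le/bigjoin_le => _ [_ [y By <-] <-].
apply/le_loc_val/bigjoin_ub.
by exists (val y) => //; exists y.
Qed.

HB.instance Definition _ := isMultLattice.Build d localization
  loc_supremums_neq0 loc_mulC loc_oneg_top loc_mulg_bigjoin.

End Localization.

(* Main.v *)
(* The argument of Anderson and Roitman for cancellation ideals carries over.
   Let Q be a cancellation element and m maximal.  Then Q / mQ is a nonzero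
   vector space over L / m.  If it had dimension at least 2, then
   Q = x v y v A with mQ <= A and Q different from both x v A and y v A.  With
   delta for x ^ 2 + y ^ 2, J = delta v xy v xA v yA v A ^ 2 satisfies
   QJ = Q ^ 3, so J = Q ^ 2 by cancellation; then, according to whether delta
   lies locally below the remaining terms of J and x ^ 2 or not,
   Q ^ 2 = Q(x v A) or Q ^ 2 = Q(y v A), a contradiction.  So Q = x v mQ with x
   principal.  As Q need not be compact, Nakayama's lemma does not apply to Q;
   but for principal b <= Q, bQ <= bx v bmQ <= Q(x v mb) gives b <= x v mb, and
   Nakayama's lemma for b yields b <= x_m, whence Q_m = x_m.
   Conversely, a principal regular element is a cancellation element, and
   a <= b holds as soon as it holds locally. *)
Require Import Defs.
From mathcomp Require Import all_boot all_order.
From mathcomp Require Import boolp classical_sets cardinality.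

Set Implicit Arguments.
Unset Strict Implicit.
Unset Printing Implicit Defensive.

Import Order.TTheory.
Local Open Scope classical_set_scope.
Local Open Scope order_scope.

(** * Principal elements at a maximal element; Nakayama's lemma *)

Section MultLattice.
Context {d : Order.disp_t} {L : multLatticeType d}.
Implicit Types (a b c m q x y z : L).

Lemma maximal_joinT m r : maximal_element m -> ~~ (r <= m) -> r `|` m = \top.
Proof.
move=> [_ mmax] rm; apply/eqP/negPn/negP => rm1.
by move: rm; rewrite -(mmax _ rm1 (leUr _ _)) leUl.
Qed.

Lemma mulg_top a : (a * \top)%g = a.
Proof. by rewrite -oneg_top mulg1. Qed.

Lemma cancellation_le q a b :
  cancellation_element q -> (q * a)%g <= (q * b)%g -> a <= b.
Proof.
move=> qc /join_r; rewrite -mulgU => /qc <-; exact: leUl.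
Qed.

Lemma meet_principal_meet x a :
  meet_principal x -> a `&` x = (residual a x * x)%g.
Proof.
move=> mx; have := mx a \top.
by rewrite (mulgC \top) mulg_top meetx1.
Qed.

Lemma join_principal_residualM x a :
  join_principal x -> residual (a * x)%g x = a `|` residual \bot x.
Proof. by move=> jx; rewrite jx joinx0. Qed.

Lemma le_residual2 a b x : a <= b -> residual a x <= residual b x.
Proof. by move=> ab; rewrite le_residual (le_trans _ ab) // -le_residual. Qed.

Lemma le_of_residual m z a :
  maximal_element m -> (m * z)%g <= a -> ~~ (residual a z <= m) -> z <= a.
Proof.
move=> mm mza /(maximal_joinT mm) rm.
by rewrite -[leLHS]mulg_top -rm mulgU leUx -le_residual lexx mulgC.
Qed.

(** By modularity it suffices that the meet of [b] and [z] lies below [a]. That meet is (b : z)z,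
    and (b : z) <= m, since otherwise [z <= b]. Modulo [a], [z] acts as a line meeting [b]
    trivially. *)
Lemma meet_join_modM m z a b :
  modular_lattice L -> maximal_element m -> meet_principal z ->
  (m * z)%g <= a -> a <= b -> ~~ (z <= b) -> b `&` (a `|` z) = a.
Proof.
move=> md mm mz mza ab zb; rewrite md // meet_principal_meet //.
apply/join_l; apply: (le_trans _ mza); apply: lemulg2r.
apply: contraNT zb; apply: (le_of_residual mm); exact: le_trans mza ab.
Qed.

(* Nakayama's lemma for the principal element [x]. *)
Lemma principal_nakayama m x a :
  modular_lattice L -> maximal_element m -> principal x ->
  x <= a `|` (m * x)%g -> ~~ (residual a x <= m).
Proof.
move=> md mm [mx jx] xa; apply/negP => am.
case: (mm) => /negP[]; rewrite -le1x.
(* Modularity gives x = mx v (a : x)x. Join principality then divides by [x] up to (0 : x), which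
   lies below (a : x) <= m. *)
have -> : \top = residual ((m `|` residual a x) * x)%g x.
  apply/le_anti; rewrite lex1 andbT le_residual mulg_top.
  rewrite (mulgC _ x) mulgU ![(x * _)%g]mulgC -meet_principal_meet //.
  by rewrite (meetC a) -md ?lemulgr // lexI lexx joinC.
rewrite join_principal_residualM // !leUx lexx am /=.
by apply: le_trans am; apply: le_residual2; exact: le0x.
Qed.

End MultLattice.

(** * Compactness, Zorn's lemma and local comparison *)

Section CLattice.
Context {d : Order.disp_t} {L : cLatticeType d}.
Implicit Types (a b c m u x y z : L) (A D : set L).

Definition directed D := forall a b, D a -> D b ->
  exists2 c, D c & a <= c /\ b <= c.

Lemma total_on_directed D : total_on D <=%O -> directed D.
Proof.
by move=> tD a b Da Db; case: (tD a b Da Db) => ab; [exists b|exists a].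
Qed.

Lemma compact_directed c D : compact_element c -> D !=set0 -> directed D ->
  c <= bigjoin D -> exists2 a, D a & c <= a.
Proof.
move=> cc [a0 Da0] dD /cc[T [/finite_seqP[r ->] rD cr]].
suff [a Da ra] : exists2 a, D a & forall t, t \in r -> t <= a.
  by exists a => //; exact: le_trans cr (bigjoin_le ra).
elim: r rD {cr} => [_|t r IH rD]; first by exists a0 => // t; rewrite in_nil.
have [|a Da ra] := IH; first by move=> u /= ur; apply: rD; rewrite /= inE ur orbT.
have [|b Db [ab tb]] := dD a t Da; first by apply: rD; rewrite /= inE eqxx.
exists b => // v; rewrite inE => /orP[/eqP -> //|/ra]; move=> /le_trans; exact.
Qed.

(** The joins of finite subsets of [A] form a directed set whose join lies above that of [A]. *)
Lemma directed_compact c :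
  (forall D, D !=set0 -> directed D -> c <= bigjoin D ->
     exists2 a, D a & c <= a) ->
  compact_element c.
Proof.
move=> cD A cA.
pose D := [set bigjoin T | T in [set T | finite_set T /\ T `<=` A]].
have [||| _ [T [finT TA] <-] cT] := cD D; last by exists T.
- by exists (bigjoin set0), set0 => //; split; [exact: finite_set0|exact: sub0set].
- move=> _ _ [T [fT TA] <-] [U [fU UA] <-]; exists (bigjoin (T `|` U)).
    by exists (T `|` U) => //; split; [rewrite finite_setU|rewrite subUset].
  by split; apply: bigjoin_le => x Tx; apply: bigjoin_ub; [left|right].
- apply: le_trans cA _; apply: bigjoin_le => a Aa; apply: bigjoin_ub.
  exists [set a]; first by split; [exact: finite_set1|move=> _ ->].
  by apply/bigjoin_eq; split => [_ ->|y]; [exact: lexx|apply].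
Qed.

Lemma meet_directed x D : D !=set0 -> directed D ->
  x `&` bigjoin D = bigjoin [set x `&` a | a in D].
Proof.
move=> D0 dD; apply/le_anti/andP; split; last first.
  by apply: bigjoin_le => _ [a Da <-]; rewrite leI2 // bigjoin_ub.
apply: compact_leP => c cc; rewrite lexI => /andP[cx].
move=> /(compact_directed cc D0 dD)[a Da ca].
by apply: (@le_trans _ _ (x `&` a)); [rewrite lexI cx|apply: bigjoin_ub; exists a].
Qed.

(** For directed [D], meet continuity and meet principality write [x] as [x] times the join of the
    (a : x). Join principality makes that join 1, and compactness of 1 yields one [a] with (a : x) =
    1. *)
Lemma principal_compact x : principal x -> compact_element x.
Proof.
move=> [mx jx]; apply: directed_compact => D [a0 Da0] dD xD.
have xE : x = (x * bigjoin [set residual a x | a in D])%g.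
  rewrite mulg_bigjoin image_comp -[LHS](meet_l xD) meet_directed //; last by exists a0.
  by congr bigjoin; apply: eq_imagel => a Da /=; rewrite meetC meet_principal_meet // mulgC.
pose E := [set residual a x | a in D].
have : (1%g : L) <= bigjoin E.
  have e1 : bigjoin E `|` residual \bot x = bigjoin E.
    apply/join_l/(@le_trans _ _ (residual a0 x)); first by rewrite le_residual2 ?le0x.
    by apply: bigjoin_ub; exists a0.
  by rewrite -e1 -join_principal_residualM // le_residual mulg1 mulgC -xE.
move=> /(compact_directed compact1)[||_ [a Da <-]].
- by exists (residual a0 x), a0.
- move=> _ _ [a Da <-] [b Db <-]; have [c Dc [ac bc]] := dD a b Da Db.
  by exists (residual c x); [exists c|rewrite !le_residual2].
by rewrite le_residual mulg1; exists a.
Qed.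

Lemma exists_maximal_avoiding x a u :
  compact_element x -> a <= u -> ~~ (x <= a) ->
  exists b, [/\ a <= b, b <= u, ~~ (x <= b) &
    forall c, b <= c -> c <= u -> ~~ (x <= c) -> c = b].
Proof.
move=> cx au xa.
pose T := {b : L | [&& a <= b, b <= u & ~~ (x <= b)]}.
have Ta : [&& a <= a, a <= u & ~~ (x <= a)] by rewrite lexx au.
have [||||t tmax] := @Zorn T (fun s t => val s <= val t).
- by move=> ?; exact: lexx.
- by move=> ? ? ?; exact: le_trans.
- by move=> s t st ts; apply/val_inj/le_anti; rewrite st ts.
(* Adjoining [a] also covers the empty chain. *)
- move=> C tC; pose D := [set a] `|` (val @` C).
  have aD b : D b -> a <= b by case=> [->|[t _ <-]]; [exact: lexx|case/and3P: (valP t)].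
  have dD : directed D.
    apply: total_on_directed => _ c [->|[s Cs <-]] Dc; first by left; exact: aD.
    by case: Dc => [->|[t Ct <-]]; [right; apply: aD; right; exists s|exact: tC].
  have Dub b : D b -> (b <= u) && ~~ (x <= b).
    by case=> [->|[t _ <-]]; [rewrite au|case/and3P: (valP t) => _ -> ->].
  have Da : D a by left.
  have Tb : [&& a <= bigjoin D, bigjoin D <= u & ~~ (x <= bigjoin D)].
    apply/and3P; split; first exact: bigjoin_ub.
      by apply: bigjoin_le => b /Dub/andP[].
    apply/negP => /(compact_directed cx)[||b /Dub/andP[_ /negP]] //.
    by exists a.
  pose t : T := exist _ (bigjoin D) Tb.
  by exists t => s Cs; apply: bigjoin_ub; right; exists s.
exists (val t); have /and3P[at_ tu xt] := valP t; split=> // c tc cu xc.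
have Tc : [&& a <= c, c <= u & ~~ (x <= c)] by rewrite (le_trans at_) ?cu.
pose t' : T := exist _ c Tc; exact: (congr1 val (tmax t' tc)).
Qed.

Lemma exists_maximal_ge a :
  a != \top -> exists2 m, maximal_element m & a <= m.
Proof.
have top_le b : (\top <= b) = (b == \top) by rewrite le1x.
rewrite -top_le => a1.
have ct : compact_element (\top : L) by rewrite -oneg_top; exact: compact1.
have [m [am _ m1 mmax]] := exists_maximal_avoiding ct (lex1 a) a1.
exists m => //; split=> [|x x1 mx]; rewrite -?top_le //.
by apply: mmax; rewrite ?lex1 ?top_le.
Qed.

Lemma le_loc_residual p (hp : prime_element p) a x :
  ~~ (residual a x <= p) -> x <= loc_val (prime_multClosed hp) a.
Proof.
move=> xap; have [s [cs sax sp]] : exists s,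
    [/\ compact_element s, s <= residual a x & ~~ (s <= p)].
  apply: contrapT => ns; case/negP: xap; apply: compact_leP => s cs sax.
  by apply/negPn/negP => sp; apply: ns; exists s.
apply: (@le_trans _ _ (residual a s)); last by apply: bigjoin_ub; exists s.
by rewrite le_residual mulgC -le_residual.
Qed.

(** If a compact [c <= a] is not below [b], some maximal [m] lies above (b : c); but [c] below [b]
    locally at [m] gives [s] not below [m] with sc <= b. *)
Lemma le_of_loc_maximal a b :
  (forall m (hm : maximal_element m),
     a <= loc_val (prime_multClosed (maximal_prime hm)) b) -> a <= b.
Proof.
move=> ab; apply: compact_leP => c cc ca.
suff : residual b c == \top.
  by move=> /eqP E; rewrite -(mulg_top c) -le_residual E.
apply/negPn/negP => /exists_maximal_ge[m hm]; apply/negP.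
have /(compact_le_loc_val _ _ cc)[s [_ sm] sc] := le_trans ca (ab m hm).
by apply: contra sm => /(le_trans _); apply; rewrite le_residual mulgC.
Qed.

(** * Localization preserves the operations and principality *)

Section Localization.
Variable S : multClosed L.

Lemma loc_valI a b : loc_val S (a `&` b) = loc_val S a `&` loc_val S b.
Proof.
apply/le_anti/andP; split; first by rewrite lexI !le_loc_val ?leIl ?leIr.
apply: compact_leP => c cc; rewrite lexI => /andP[].
move=> /(compact_le_loc_val _ _ cc)[s Ss sa] /(compact_le_loc_val _ _ cc)[t St tb].
apply/(compact_le_loc_val _ _ cc); exists (s * t)%g; first exact: multClosedM.
rewrite lexI {1}(mulgC s) -!mulgA (le_trans _ sa) ?(le_trans _ tb) //;
  by rewrite ?lemulgr.
Qed.

Lemma locI a b : loc S a `&` loc S b = loc S (a `&` b).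
Proof.
by apply: val_inj; rewrite [LHS]val_loc_meet !val_loc -loc_valI.
Qed.

Lemma locU a b : loc S a `|` loc S b = loc S (a `|` b).
Proof.
apply/le_anti; rewrite leUx !loc_le leUx -!loc_le leUl leUr !andbT /=.
by rewrite !loc_le !(le_trans _ (loc_val_ge _ _)) ?leUl ?leUr.
Qed.

Lemma locM a b : (loc S a * loc S b)%g = loc S (a * b)%g.
Proof.
by apply: val_inj; exact: etrans (loc_valMl S a _) (loc_valMr S a b).
Qed.

(** For compact [k], xk is compact too, so a single [s] witnesses that xk lies below [a] locally. *)
Lemma residual_loc a x : compact_element x ->
  residual (loc S a) (loc S x) = loc S (residual a x).
Proof.
move=> cx; apply/le_anti/andP; split; last first.
  by rewrite le_residual locM loc_le (le_trans _ (loc_val_ge _ _)) // -le_residual.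
have := lexx (residual (loc S a) (loc S x)); set c := {1}(residual _ _).
rewrite -(valK_loc c) le_residual locM loc_le => xca.
rewrite leE_loc; apply: compact_leP => k ck kc.
have := le_trans (lemulg2l x kc) xca.
move=> /(compact_le_loc_val _ _ (compactM _ _ cx ck))[s Ss sa].
apply/(compact_le_loc_val _ _ ck); exists s => //.
by rewrite le_residual mulgA (mulgC x) -mulgA.
Qed.

Lemma principal_loc x : principal x -> principal (loc S x).
Proof.
move=> px; have cx := principal_compact px; case: px => mx jx.
split=> a b; rewrite -(valK_loc a) -(valK_loc b).
  by rewrite residual_loc // locM !locI locM mx.
by rewrite residual_loc // locM !locU residual_loc // jx.
Qed.

End Localization.
End CLattice.

(** * Cancellation elements *)

Lemma principal_regular_cancellation d (L : multLatticeType d) (x : L) :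
  principal_regular x -> cancellation_element x.
Proof.
move=> [[_ jx] x0] a b xab.
have E c : residual (c * x)%g x = c.
  by rewrite join_principal_residualM // x0 joinx0.
by rewrite -(E a) -(E b) mulgC xab mulgC.
Qed.

Lemma generating_le d (L : multLatticeType d) (D : set L) (a b : L) :
  generating D -> (forall x, D x -> x <= a -> x <= b) -> a <= b.
Proof.
move=> gD Dab; have [A AD aA] := gD a.
rewrite {1}aA; apply: bigjoin_le => x Ax; apply: Dab; first exact: AD.
by rewrite aA bigjoin_ub.
Qed.

(* Here [z] plays the role of the element [x ^+ 2 + y ^+ 2] of a ring. *)
Lemma cancellation_split d (L : multLatticeType d) (m q x y a z : L) :
  modular_lattice L -> maximal_element m -> cancellation_element q ->
  q = (x `|` y) `|` a -> (m * q)%g <= a -> meet_principal z ->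
  (x * x)%g `|` (y * y)%g = (x * x)%g `|` z ->
  (x * x)%g `|` z = (y * y)%g `|` z ->
  q <= x `|` a \/ q <= y `|` a.
Proof.
move=> md mm qc qE mqa mz xyz xzyz.
have xq : x <= q by rewrite qE -joinA leUl.
have yq : y <= q by rewrite qE (joinC x) -joinA leUl.
have aq : a <= q by rewrite qE leUr.
(* The terms of q^2 other than x^2 and y^2; z v B is the element J of the overview. *)
pose B := ((x * y)%g `|` (x * a)%g) `|` ((y * a)%g `|` (a * a)%g).
have [xyB xaB yaB aaB] : [/\ (x * y)%g <= B, (x * a)%g <= B, (y * a)%g <= B
    & (a * a)%g <= B].
  by split; rewrite /B; [do 2 apply: lexUl|apply/lexUl/lexUr|apply/lexUr/lexUl|do 2 apply: lexUr].
have mulS (s t u v : L) : s <= t -> u <= v -> (s * u)%g <= (t * v)%g.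
  by move=> st uv; apply: le_trans (lemulg2l _ uv) (lemulg2r _ st).
have qq_le (e : L) : (x * x)%g <= e -> (y * y)%g <= e -> B <= e -> (q * q)%g <= e.
  move=> xe ye Be; have {}Be t : t <= B -> t <= e by move/le_trans; apply.
  rewrite {2}qE !mulgU (mulgC q x) (mulgC q y) (mulgC q a) {1 2 3}qE !mulgU !leUx xe ye.
  by rewrite (mulgC y x) (mulgC a x) (mulgC a y) !Be.
have Bq (e : L) : (x `|` a <= e) || (y `|` a <= e) -> B <= (q * e)%g.
  rewrite !leUx -andb_orl => /andP[xye ae]; rewrite !(mulS _ q a e) // !andbT.
  by case/orP: xye => ?; [rewrite mulgC|]; apply: mulS.
have zqq : z <= (q * q)%g.
  by apply: (@le_trans _ _ ((x * x)%g `|` z)); rewrite ?leUr // -xyz leUx !mulS.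
have qqE : (q * q)%g = z `|` B.
  apply: qc; apply/le_anti/andP; split; last first.
    apply: lemulg2l; by rewrite leUx zqq Bq // leUx xq aq.
  have eJ u t : u <= q -> t <= z `|` B -> (u * t)%g <= (q * (z `|` B))%g.
    exact: mulS.
  have [xyJ xaJ] : (x * y)%g <= z `|` B /\ (x * a)%g <= z `|` B.
    by split; apply: lexUr.
  (* The critical term is x^3 <= x(y^2 v z) = y(xy) v xz; the others are x(xy) and x(xa). *)
  have xxJ : (q * (x * x))%g <= (q * (z `|` B))%g.
    move: eJ; set e := (q * (z `|` B))%g => eJ.
    rewrite qE mulgC !mulgU !leUx -!mulgA.
    rewrite (eJ x _ xq xyJ) (eJ x _ xq xaJ) !andbT.
    apply: (@le_trans _ _ (x * ((y * y)%g `|` z))%g).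
      by rewrite lemulg2l // -xzyz leUl.
    rewrite mulgU leUx (eJ x z) ?leUl // andbT.
    by rewrite mulgA mulgC eJ.
  apply: (@le_trans _ _ (q * ((x * x)%g `|` (z `|` B)))%g).
    apply/lemulg2l/qq_le; rewrite ?leUl // joinA; last exact: leUr.
    by rewrite -xyz -joinA (joinC (x * x)%g) -joinA leUl.
  by rewrite mulgU leUx xxJ lexx.
have mzB : (m * z)%g <= B.
  apply: (@le_trans _ _ (m * ((x * x)%g `|` z))%g); first by rewrite lemulg2l ?leUr.
  rewrite -xyz mulgU leUx; apply/andP; split.
    apply: le_trans xaB; rewrite mulgA mulgC lemulg2l // (le_trans _ mqa) //.
    exact: lemulg2l.
  apply: le_trans yaB; rewrite mulgA mulgC lemulg2l // (le_trans _ mqa) //.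
  exact: lemulg2l.
have [zb|zb] := boolP (z <= (x * x)%g `|` B); [left|right]; apply: (cancellation_le qc).
  have xa : (x * x)%g `|` B <= (q * (x `|` a))%g.
    by rewrite leUx Bq ?lexx ?leUx ?xq ?aq // mulS ?leUl.
  apply: le_trans xa; apply: qq_le; rewrite ?leUl ?leUr //.
  apply: (@le_trans _ _ ((x * x)%g `|` z)); first by rewrite -xyz leUr.
  by rewrite leUx leUl.
(* Since x^2 <= q^2 = z v B, x^2 lies in the meet of x^2 v B and B v z, which is [B] because [z] is
   not below x^2 v B. *)
have xxB : (x * x)%g <= B.
  rewrite -(meet_join_modM md mm mz mzB (leUr _ _) zb) lexI leUl joinC -qqE.
  exact: mulS.
have BQ : B <= (q * (y `|` a))%g by rewrite Bq ?lexx ?orbT ?leUx ?yq ?aq.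
by apply: qq_le => //; [exact: le_trans BQ|rewrite mulS ?leUl].
Qed.

(** * Dimension one modulo [m * q] *)

Section RLattice.
Context {d : Order.disp_t} {L : rLatticeType d}.
Implicit Types (a b m q x y : L).

(* As [b] is in effect a vector space over [L / m] modulo [a], a maximal [c]
   avoiding [y] is a hyperplane of [b]. *)
Lemma exists_complement m a b y :
  maximal_element m -> principal y -> a <= b -> y <= b -> ~~ (y <= a) ->
  (m * b)%g <= a ->
  exists c, [/\ a <= c, c <= b, ~~ (y <= c) & b <= c `|` y].
Proof.
move=> mm py ab yb ya mba.
have [c [ac cb yc cmax]] := exists_maximal_avoiding (principal_compact py) ab ya.
exists c; split=> //; have [D DP gD] := @principal_generating d L.
apply: (generating_le gD) => z /DP[mz _] zb; apply/negPn/negP => zcy.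
have mzc : (m * z)%g <= c by apply: le_trans (lemulg2l m zb) (le_trans mba ac).
(* Thus [y] cannot lie below c v z without lying below [c]; maximality of [c] then forces
   [z <= c]. *)
have E := meet_join_modM (@rlattice_modular _ L) mm mz mzc (leUl c y) zcy.
have [ycz|ycz] := boolP (y <= c `|` z).
  by move: yc; rewrite -E lexI leUr ycz.
have zc : c `|` z = c by apply: cmax; rewrite ?leUl // leUx cb.
by move: zcy; rewrite -zc lexUl // leUr.
Qed.

Lemma cancellation_principal_mod m q :
  property_delta L -> maximal_element m -> cancellation_element q ->
  exists x, [/\ principal x, x <= q & q <= x `|` (m * q)%g].
Proof.
move=> [D [DP gD delta]] mm qc; have md := @rlattice_modular _ L.
have exD a b : ~~ (a <= b) -> exists x, [/\ D x, x <= a & ~~ (x <= b)].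
  move=> nab; apply: contrapT => nx; case/negP: nab.
  apply: (generating_le gD) => x Dx xa; apply/negPn/negP => xb.
  by apply: nx; exists x.
have [|x [Dx xq xmq]] := exD q (m * q)%g.
  apply/negP => qmq; case: (mm) => /negP[]; rewrite -le1x.
  by apply: (cancellation_le qc); rewrite mulg_top mulgC.
exists x; split; [exact: DP|by []|apply/negPn/negP => /exD[y [Dy yq yxmq]]].
(* [B] is a hyperplane of [q] containing [x] but not [y]; next, [A] is a hyperplane of [B] missing
   [x]. *)
have [||B [xmB Bq yB qBy]] := exists_complement mm (DP _ Dy) _ yq yxmq.
- by rewrite leUx xq lemulgr.
- exact: leUr.
move: xmB; rewrite leUx => /andP[xB mqB].
have [|A [mqA AB xA BAx]] := exists_complement mm (DP _ Dx) mqB xB xmq.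
  exact: lemulg2l.
have [z Dz [xyz xzyz]] := delta x y Dx Dy.
have qE : q = (x `|` y) `|` A.
  apply/le_anti; rewrite !leUx xq yq (le_trans AB Bq) !andbT.
  apply: le_trans qBy _; rewrite leUx; apply/andP; split.
    by rewrite (le_trans BAx) // joinC joinAC leUl.
  by rewrite joinAC lexUr.
have [] := cancellation_split md mm qc qE mqA (proj1 (DP _ Dz)) xyz xzyz => qA.
  by case/negP: yB; rewrite (le_trans yq) // (le_trans qA) // leUx xB.
have myA : (m * y)%g <= A := le_trans (lemulg2l m yq) mqA.
case/negP: xA; rewrite -(meet_join_modM md mm (proj1 (DP _ Dy)) myA AB yB).
by rewrite lexI xB joinC (le_trans xq).
Qed.

End RLattice.

Theorem theorem2 (d : Order.disp_t) (L : rLatticeType d)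
    (hL : property_delta L) (Q : L) :
  cancellation_element Q <->
  forall (m : L) (hm : maximal_element m),
    principal_regular (loc (prime_multClosed (maximal_prime hm)) Q).
Proof.
have [G GP gG] := @principal_generating d L.
have md := @rlattice_modular _ L.
split=> [Qc m hm|Qloc a b Qab]; last first.
  suff H u v : (Q * u)%g = (Q * v)%g -> u <= v.
    by apply/le_anti; rewrite !H.
  move=> Quv; apply: le_of_loc_maximal => m hm.
  have /principal_regular_cancellation := Qloc m hm.
  set S := prime_multClosed _ => Qc.
  have uv : loc S u = loc S v by apply: Qc; rewrite !locM Quv.
  by have := loc_val_ge S u; rewrite -val_loc uv.
set S := prime_multClosed _.
have [x [px xQ Qx]] := cancellation_principal_mod hL hm Qc.
have -> : loc S Q = loc S x.
  apply/val_inj/le_anti; rewrite !val_loc (le_loc_val _ xQ) andbT.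
  apply: loc_val_le; apply: (generating_le gG) => b /GP pb bQ.
  apply/le_loc_residual/(principal_nakayama md hm pb).
  (* Multiplying Q <= x v mQ by [b <= Q] bounds Qb by Q(x v mb). *)
  apply: (cancellation_le Qc); apply: le_trans (lemulg2r b Qx) _.
  rewrite (mulgC _ b) !mulgU leU2 //; first exact: lemulg2r.
  by rewrite mulgA mulgC (mulgC b).
split; first exact: principal_loc.
rewrite residual_loc; last exact: principal_compact.
apply/le_anti; rewrite le0x andbT loc_le.
apply: (generating_le gG) => b /GP pb bx.
apply/le_loc_residual/(principal_nakayama md hm pb).
apply: (cancellation_le Qc).
(* With xb = 0, the same bound becomes Qb <= Q(mb), so b <= mb and Nakayama's lemma makes [b] vanish
   locally. *)
have xb : (x * b)%g = \bot by apply/eqP; rewrite -lex0 -le_residual.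
apply: le_trans (lemulg2r b Qx) _.
rewrite join0x (mulgC _ b) mulgU (mulgC b x) xb join0x.
by rewrite mulgA mulgC (mulgC b).
Qed.
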